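(* Let $\Bbbk$ be a field of characteristic zero, let $\mathfrak{h}$ be the $3$-dimensional Heisenberg Lie algebra over $\Bbbk$, and let $\Bbbk^2$ be the $2$-dimensional abelian Lie algebra, so that $C^*(\Bbbk^2\oplus\mathfrak{h},\Bbbk)$ is the exterior algebra on generators $v,w$ (a basis of $(\Bbbk^2)^*$) and $x,y,z$ (a basis of $\mathfrak{h}^*$) of degree $1$, with differential $d(v)=d(w)=d(x)=d(y)=0$, $d(z)=xy$. Let $i\colon C^*(\Bbbk^2\oplus\mathfrak{h},\Bbbk)\to C^*(\Bbbk^2\oplus\mathfrak{h},\Bbbk)$ be the chain map of cohomological degree $-2$ given on the basis of lexicographically ordered monomials by $i(vwx)=y$ and zero on all other basis elements, and equip $C^*(\Bbbk^2\oplus\mathfrak{h},\Bbbk)$ with the DG-hypercommutative algebra structure induced by the trivialization $e^{it}$ of the trivial Batalin–Vilkovisky operator $\Delta=0$. Let $$\Gamma=m_3\circ_1m_2+(m_2\circ_1m_3)\cdot(3\;4)-m_3\circ_2m_2-m_2\circ_2m_3.$$ Then the Massey product $\langle\bar v\bar w,\bar v\bar x,\bar x,\bar x\rangle_\Gamma$, a coset in $H^3(\Bbbk^2\oplus\mathfrak{h},\Bbbk)$, is well defined and non-trivial; moreover $$\langle\bar v\bar w,\bar v\bar x,\bar x,\bar x\rangle_\Gamma\cap\bigl((\Bbbk^2)^*\otimes H^2(\mathfrak{h},\Bbbk)\bigr)=\{\bar v\,\overline{xz}\}.$$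
   Context: **Hypercommutative algebras.** A hypercommutative algebra is a graded vector space $A$ with graded symmetric multiplications $(x_1,\dots,x_r)$ of arity $r$ and homological degree $2(r-2)$, $r\ge2$, satisfying for all $r\geq 0$ $$\sum_{S_1\amalg S_2=\{1,\dots,r\}}\pm((a,b,x_{S_1}),c,x_{S_2})=\sum_{S_1\amalg S_2=\{1,\dots,r\}}\pm(a,(b,c,x_{S_1}),x_{S_2})$$ with Koszul signs relative to the order $a,b,c,x_1,\dots,x_r$ (here $x_S=x_{i_1},\dots,x_{i_s}$ for $S=\{i_1<\dots<i_s\}$). The corresponding operad is quadratic Koszul, generated by $m_r$ (arity $r$, homological degree $2(r-2)$, trivial $\mathbb{S}_r$-action), $r\ge2$. The binary operation is a commutative product $ab=(a,b)$, and the relation $\Gamma$ corresponds to $$(ab,c,x)+(-1)^{|c||x|}(a,b,x)c=a(b,c,x)+(a,bc,x).$$ **Cohomological grading.** Cochain complexes are viewed as chain complexes by $H^n=H_{-n}$; so on $C^*(\Bbbk^2\oplus\mathfrak{h},\Bbbk)$ the arity $3$ product has cohomological degree $-2$. An overline denotes a cohomology class. By Künneth, $H^*(\Bbbk^2\oplus\mathfrak{h},\Bbbk)=\bigl(\bigwedge(\Bbbk^2)^*\bigr)\otimes H^*(\mathfrak{h},\Bbbk)$, and $H^2(\mathfrak{h},\Bbbk)$ has basis $\{\overline{xz},\overline{yz}\}$; the subspace $(\Bbbk^2)^*\otimes H^2(\mathfrak{h},\Bbbk)\subset H^3(\Bbbk^2\oplus\mathfrak{h},\Bbbk)$ is the corresponding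 direct summand. **The hypercommutative structure.** A DG-Batalin–Vilkovisky algebra $(A,d,\Delta)$ with a trivialization, i.e. a chain isomorphism $(A[[t]],d+\Delta t)\cong(A[[t]],d)$ with $t$ a formal parameter of homological degree $-2$, acquires a DG-hypercommutative algebra structure (Khoroshkin–Markarian–Shadrin). Here $A=C^*(\Bbbk^2\oplus\mathfrak{h},\Bbbk)$, $\Delta=0$, and the trivialization is $e^{it}$. The resulting binary operation $m_2$ is the exterior product and the resulting arity $3$ operation $m_3$ is $$(a,b,c)=i(abc)-i(ab)c-(-1)^{|b||c|}i(ac)b-a\,i(bc)+i(a)bc+a\,i(b)c+ab\,i(c).$$ Only $m_2$ and $m_3$ enter the definition of the Massey product in the claim. **Massey products.** For an operad with generators $E$ and a quadratic relation $\Gamma=\sum(\mu^{(1)}\circ_l\mu^{(2)})\cdot\sigma$ of arity $r$ ($\mu^{(i)}\in E(r_i)$, $\sigma\in\mathbb{S}_r$, coefficients absorbed in the $\mu$'s), a DG-algebra $A$ over it, and classes $x_1,\dots,x_r\in H_*(A)$ with $\mu^{(2)}(x_{\sigma^{-1}(l)},\dots,x_{\sigma^{-1}(l+r_2-1)})=0$ for each summand, choose representing cycles $y_i$ and elements $\rho^{(2)}$ with $d(\rho^{(2)})=\mu^{(2)}(y_{\sigma^{-1}(l)},\dots,y_{\sigma^{-1}(l+r_2-1)})$. The Massey product $\langle x_1,\dots,x_r\rangle_\Gamma$ is the coset in $H_{|\Gamma|+\sum|x_i|+1}(A)$ of the class of the cycle $$\sum(-1)^{\gamma}\mu^{(1)}(y_{\sigma^{-1}(1)},\dots,y_{\sigma^{-1}(l-1)},\rho^{(2)},y_{\sigma^{-1}(l+r_2)},\dots,y_{\sigma^{-1}(r)}),\quad\gamma=\alpha+|\mu^{(1)}|+(|\mu^{(2)}|-1)\sum_{m=1}^{l-1}|x_{\sigma^{-1}(m)}|,\quad\alpha=\sum_{\substack{s<t\\\sigma(s)>\sigma(t)}}|x_s||x_t|,$$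 modulo the indeterminacy, i.e. the sum over the summands of $\Gamma$ of the subspaces $\mu^{(1)}(x_{\sigma^{-1}(1)},\dots,x_{\sigma^{-1}(l-1)},H_{|\mu^{(2)}|+\sum_{i=1}^{r_2}|x_{\sigma^{-1}(l+i-1)}|+1}(A),x_{\sigma^{-1}(l+r_2)},\dots,x_{\sigma^{-1}(r)})$. It is independent of choices; non-trivial means that the coset does not contain $0$. The right action of permutations is $(\mu\cdot\sigma)(a_1,\dots,a_r)=(-1)^{\alpha}\mu(a_{\sigma^{-1}(1)},\dots,a_{\sigma^{-1}(r)})$ with $\alpha$ formed from the $|a_i|$. *)

(* Defs.v *)
From HB Require Import structures.
From mathcomp Require Import all_boot all_order all_algebra all_fingroup.
From mathcomp Require Import boolp classical_sets.

Set Implicit Arguments.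
Unset Strict Implicit.
Unset Printing Implicit Defensive.

Import GRing.Theory.
Local Open Scope ring_scope.
Local Open Scope quotient_scope.

Record generators := Generators {
  gen :> Type;
  arity : gen -> nat;
  gdeg : gen -> int (* homological degree *)
}.

(* The summand [qcoef * (qouter o_l qinner) . qperm] of a quadratic relation of
   arity [r], where [l = qpos] is counted from 1. *)
Record qterm (k : fieldType) (E : generators) (r : nat) := QTerm {
  qcoef : k;
  qouter : E;
  qpos : nat;
  qinner : E;
  qperm : 'S_r
}.

(* The data of a DG-algebra over an operad generated by [E], with homological
   grading.  An operation [op mu] takes the list of its arguments and is only
   meaningful on lists of length [arity mu].  Massey products are defined from
   these data alone, so the record carries no algebraic laws. *)
Record dg_data (k : fieldType) (E : generators) := DGData {
  carrier :> lmodType k;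
  homog : int -> set carrier;
  diff : {linear carrier -> carrier};
  op : E -> seq carrier -> carrier
}.

Section Homology.
Variables (k : fieldType) (E : generators) (A : dg_data k E).

Definition cycles (n : int) : set A :=
  [set a | homog n a /\ diff A a = 0]%classic.

Definition boundaries : {pred A} := fun b => `[< exists a : A, b = diff A a >].

Fact boundaries_zmod_closed : zmod_closed boundaries.
Proof.
split; first by apply/asboolP; exists 0; rewrite linear0.
move=> _ _ /asboolP[a ->] /asboolP[b ->]; apply/asboolP.
by exists (a - b); rewrite linearB.
Qed.

HB.instance Definition _ :=
  GRing.isZmodClosed.Build A boundaries boundaries_zmod_closed.

(* Homology lives in the quotient of the whole of [A] by the boundaries;
   [H_n(A)] is the subset [homology_deg n] of classes of cycles. *)
Definition homology : zmodType := {ideal_quot boundaries}.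

Definition hclass (a : A) : homology := \pi_{ideal_quot boundaries} a.

Definition homology_deg (n : int) : set homology :=
  [set hclass a | a in cycles n]%classic.

Lemma hclass_eq (a b : A) :
  hclass a = hclass b <-> exists c : A, a - b = diff A c.
Proof.
rewrite /hclass; split=> [/eqP|[c ac]].
  by rewrite -Quotient.idealrBE => /asboolP.
by apply/eqP; rewrite -Quotient.idealrBE; apply/asboolP; exists c.
Qed.

Lemma hclassD (a b : A) : hclass (a + b) = hclass a + hclass b.
Proof. by rewrite /hclass !piE. Qed.

Lemma hclass0 : hclass 0 = 0.
Proof. by rewrite /hclass !piE. Qed.

End Homology.

Section Massey.
Variables (k : fieldType) (E : generators) (A : dg_data k E).
Variables (r p : nat) (Gamma : p.-tuple (qterm k E r)).

(* The list [y_(s^-1(1)), ..., y_(s^-1(r))]. *)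
Definition permuted (T : Type) (s : 'S_r) (y : r.-tuple T) : seq T :=
  [seq tnth y ((s^-1)%g j) | j <- enum 'I_r].

Section Term.
Variable t : qterm k E r.

Definition inner_args (T : Type) (y : r.-tuple T) : seq T :=
  take (arity (qinner t)) (drop (qpos t).-1 (permuted (qperm t) y)).

Definition outer_args (T : Type) (y : r.-tuple T) (u : T) : seq T :=
  let s := permuted (qperm t) y in
  take (qpos t).-1 s ++ u :: drop ((qpos t).-1 + arity (qinner t)) s.

Definition inner_val (y : r.-tuple A) : A := op (qinner t) (inner_args y).

(* The outer operation, with the coefficient of the summand absorbed. *)
Definition outer_val (y : r.-tuple A) (u : A) : A :=
  qcoef t *: op (qouter t) (outer_args y u).

(* Below, [n] is the tuple of the degrees |x_1|, ..., |x_r|. *)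
Definition rho_deg (n : r.-tuple int) : int :=
  gdeg (qinner t) + \sum_(m <- inner_args n) m + 1.

Definition koszul_exp (n : r.-tuple int) : int :=
  \sum_(i < r) \sum_(j < r | (i < j)%N && (qperm t j < qperm t i)%N)
     tnth n i * tnth n j.

Definition massey_exp (n : r.-tuple int) : int :=
  koszul_exp n + gdeg (qouter t)
  + (gdeg (qinner t) - 1)
    * \sum_(m <- take (qpos t).-1 (permuted (qperm t) n)) m.

End Term.

Variables (n : r.-tuple int) (x : r.-tuple (homology A)).

Definition represents (y : r.-tuple A) : Prop :=
  forall i, cycles (tnth n i) (tnth y i) /\ hclass (tnth y i) = tnth x i.

Definition massey_defined : Prop :=
  (forall i, homology_deg (tnth n i) (tnth x i)) /\
  (forall y j, represents y -> hclass (inner_val (tnth Gamma j) y) = 0).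

Definition massey_system (y : r.-tuple A) (rho : 'I_p -> A) : Prop :=
  represents y /\
  forall j, homog (rho_deg (tnth Gamma j) n) (rho j) /\
            diff A (rho j) = inner_val (tnth Gamma j) y.

Definition massey_cycle (y : r.-tuple A) (rho : 'I_p -> A) : A :=
  \sum_(j < p) (-1) ^ massey_exp (tnth Gamma j) n
               *: outer_val (tnth Gamma j) y (rho j).

Definition indeterminacy (y : r.-tuple A) : set (homology A) :=
  [set h | exists u : 'I_p -> A,
     (forall j, cycles (rho_deg (tnth Gamma j) n) (u j)) /\
     h = \sum_(j < p) hclass (outer_val (tnth Gamma j) y (u j))]%classic.

Definition massey_coset (y : r.-tuple A) (rho : 'I_p -> A) : set (homology A) :=
  [set hclass (massey_cycle y rho) + h | h in indeterminacy y]%classic.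

Definition massey_product : set (homology A) :=
  [set h | exists y rho, massey_system y rho /\ massey_coset y rho h]%classic.

(* The product is defined, it is the coset given by any choice of
   representatives and of the elements [rho], and it lies in [H_N(A)]. *)
Definition massey_well_defined (N : int) : Prop :=
  [/\ massey_defined,
      exists y rho, massey_system y rho,
      forall y rho, massey_system y rho ->
        cycles N (massey_cycle y rho) /\ massey_product = massey_coset y rho
    & (massey_product `<=` homology_deg (A := A) N)%classic].

End Massey.

(* An element of the exterior algebra on [n] ordered generators is given by its
   coordinates on the increasing monomials, indexed by subsets of ['I_n].
   Beware that [*%R] on this type is the pointwise product, not the exterior
   one. *)
Notation ext k n := {ffun {set 'I_n} -> k^o}.

Section Exterior.
Variables (k : fieldType) (n : nat).
Implicit Types (a b : ext k n) (S T U : {set 'I_n}).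

Definition monomial S : ext k n := [ffun T : {set 'I_n} => (T == S)%:R].

Definition ext_gen (g : 'I_n) : ext k n := monomial [set g].

Definition inversions S T : nat :=
  #|[set q : 'I_n * 'I_n | [&& q.1 \in S, q.2 \in T & (q.2 < q.1)%N]]|.

Definition wedge a b : ext k n :=
  [ffun U : {set 'I_n} => \sum_(S : {set 'I_n} | S \subset U)
     (-1) ^+ inversions S (U :\: S) * (a S * b (U :\: S))].

Definition ext_deg (m : nat) a : Prop := forall S, a S != 0 -> #|S| = m.

Definition ext_comp (m : nat) a : ext k n :=
  [ffun S : {set 'I_n} => if #|S| == m then a S else 0].

(* The odd derivation with value [f g] on the generator [g]. *)
Definition derivation (f : 'I_n -> ext k n) a : ext k n :=
  \sum_S a S *: \sum_(g in S)
    (-1) ^+ #|[set h in S | (h < g)%N]|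
    *: wedge (wedge (monomial [set h in S | (h < g)%N]) (f g))
             (monomial [set h in S | (g < h)%N]).

Fact derivation_is_linear f : linear (derivation f).
Proof.
move=> c a b; rewrite /derivation scaler_sumr -big_split /=.
by apply: eq_bigr => S _; rewrite !ffunE scalerDl scalerA.
Qed.

HB.instance Definition _ f :=
  GRing.isLinear.Build k (ext k n) (ext k n) *:%R (derivation f)
    (derivation_is_linear f).

End Exterior.

Notation "a '\w' b" := (wedge a b) (at level 40, left associativity)
  : ring_scope.

Definition iv : 'I_5 := @Ordinal 5 0 isT.
Definition iw : 'I_5 := @Ordinal 5 1 isT.
Definition ix : 'I_5 := @Ordinal 5 2 isT.
Definition iy : 'I_5 := @Ordinal 5 3 isT.
Definition iz : 'I_5 := @Ordinal 5 4 isT.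

Section Cochains.
Variable k : fieldType.
Notation C := (ext k 5).
Implicit Types a b c : C.

Definition gv : C := ext_gen k iv.
Definition gw : C := ext_gen k iw.
Definition gx : C := ext_gen k ix.
Definition gy : C := ext_gen k iy.
Definition gz : C := ext_gen k iz.

Definition ce_diff_gen (g : 'I_5) : C := if g == iz then gx \w gy else 0.

Definition ce_diff : {linear C -> C} := derivation ce_diff_gen.

Definition contr a : C := a [set iv; iw; ix] *: gy.

(* The arity 3 product obtained from [Delta = 0] and the trivialization
   [e^(it)].  The sign [(-1)^(|b||c|)] is extended linearly to inhomogeneous
   [b] and [c]. *)
Definition triv_m3 (i : C -> C) a b c : C :=
  i (a \w b \w c) - i (a \w b) \w c
  - \sum_(s < 6) \sum_(t < 6)
      (-1) ^+ (s * t) *: (i (a \w ext_comp t c) \w ext_comp s b)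
  - a \w i (b \w c)
  + i a \w b \w c + a \w i b \w c + a \w b \w i c.

End Cochains.

(* The index [j] stands for the generator [m_(j+2)], of degree [2 j]. *)
Definition hycom : generators :=
  Generators (fun j : nat => j.+2) (fun j : nat => (2 * j)%:Z).

Definition m_2 : hycom := 0%N.
Definition m_3 : hycom := 1%N.

(* The term of [m_r] coming from the trivialization [e^(it)] contains [r - 2]
   copies of [i].  The image of the present [i] is spanned by [y], [i] vanishes
   on the ideal [(y)], and [y \w y = 0], so that [m_r = 0] for [r >= 4]. *)
Definition ce_op (k : fieldType) (m : hycom) (s : seq (ext k 5)) : ext k 5 :=
  match m, s with
  | 0%N, [:: a; b] => a \w b
  | 1%N, [:: a; b; c] => triv_m3 (@contr k) a b c
  | _, _ => 0
  end.

(* Cohomological degree [m] is homological degree [- m]. *)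
Definition ce_homog (k : fieldType) (n : int) : set (ext k 5) :=
  [set a : ext k 5 | forall S : {set 'I_5}, a S != 0 -> n = - (#|S|)%:Z]%classic.

Definition ce_hycom (k : fieldType) : dg_data k hycom :=
  DGData (@ce_homog k) (ce_diff k) (@ce_op k).

(* The transposition (3 4), on indices counted from 0. *)
Definition perm34 : 'S_4 := tperm (@Ordinal 4 2 isT) (@Ordinal 4 3 isT).

Definition Gamma (k : fieldType) : 4.-tuple (qterm k hycom 4) :=
  [tuple QTerm   1  m_3 1 m_2 1%g;
         QTerm   1  m_2 1 m_3 perm34;
         QTerm (-1) m_3 2 m_2 1%g;
         QTerm (-1) m_2 2 m_3 1%g].

Section Summand.
Variable k : fieldType.

(* The cocycles of degree [m] of the subalgebra on [x], [y], [z], which is the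
   complex of cochains on [h]. *)
Definition heis_cocycles (m : nat) : set (ext k 5) :=
  [set b : ext k 5 | [/\ forall S : {set 'I_5}, b S != 0 -> S \subset [set ix; iy; iz],
               ext_deg m b & ce_diff k b = 0]]%classic.

(* The image of [(k^2)^* (x) H^2(h)] in the cohomology of [k^2 + h] under the
   Kunneth isomorphism. *)
Definition kunneth_1_2 : set (homology (ce_hycom k)) :=
  [set h | exists b1 b2, [/\ heis_cocycles 2 b1, heis_cocycles 2 b2 &
     h = hclass (A := ce_hycom k) (gv k \w b1 + gw k \w b2)]]%classic.

End Summand.

(* Main.v *)
Require Import Defs.
From mathcomp Require Import all_boot all_order all_algebra all_fingroup.
From mathcomp Require Import boolp classical_sets.
From HB Require Import structures.
From mathcomp Require Import ring.
Import GRing.Theory.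
Local Open Scope ring_scope.

Set Implicit Arguments.
Unset Strict Implicit.
Unset Printing Implicit Defensive.

(* The cocycles representing the four classes are vw + r xy, vx + s xy, x and x.
   The first, third and fourth inner products of Gamma are exact or zero already
   because the exterior products involved are, while the triple product of the
   representatives of vw, vx, x is - i(vwx) vx = - vxy = d(vz), whatever r and s.
   This contributes - (vz) x = vxz to the Massey product.  The remaining freedom
   consists of cocycles of degrees 1 and 2 (elements of degree 3 are killed by
   the outer product), and the outer products send these into the span of vwx,
   vwy, xyz and of the boundaries vxy, wxy.  The image of d is spanned by xy, vxy,
   wxy, vwxy, so vxz is not cohomologous to an element of this span, and no
   nonzero class of this span lies in (k^2)^* (x) H^2(h). *)

(** * Exterior products of sparse linear combinations of monomials *)

Section Sparse.
Variables (k : fieldType) (n : nat).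
Local Notation C := (ext k n).
Implicit Types (s t : seq nat) (a b : C) (l : seq (k * seq nat)).

Definition supp s : {set 'I_n} := [set i : 'I_n | val i \in s].

(** Canonical form of an exponent list: sorted, without repetitions, entries below [n]. Supports are
    then compared by closed computation on lists of naturals, whereas finite sets do not reduce. *)
Definition nf s : seq nat := [seq i <- iota 0 n | i \in s].

Lemma mem_nf s i : (i \in nf s) = (i < n)%N && (i \in s).
Proof. by rewrite mem_filter mem_iota andbC. Qed.

Lemma supp_nf s : supp (nf s) = supp s.
Proof. by apply/setP=> i; rewrite !inE mem_nf ltn_ord. Qed.

Lemma eq_supp s t : (supp s == supp t) = (nf s == nf t).
Proof.
apply/eqP/eqP=> [st | st]; last by rewrite -supp_nf st supp_nf.
apply: eq_in_filter => i; rewrite mem_iota /= add0n => i_n.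
by move/setP/(_ (Ordinal i_n)): st; rewrite !inE.
Qed.

Lemma supp_surj (S : {set 'I_n}) : supp [seq val i | i <- enum S] = S.
Proof. by apply/setP=> i; rewrite inE mem_map ?mem_enum //; exact: val_inj. Qed.

Lemma big_supp (R : nmodType) s (F : nat -> R) :
  \sum_(i in supp s) F i = \sum_(i <- nf s) F i.
Proof.
have nE : iota 0 n = index_iota 0 n by rewrite /index_iota subn0.
rewrite big_filter nE big_mkord.
by apply: eq_bigl => i; rewrite inE.
Qed.

Lemma card_supp s : #|supp s| = size (nf s).
Proof. by rewrite -sum1_card (big_supp s (fun=> 1%N)) sum1_size. Qed.

Definition inv_count s t : nat :=
  sumn [seq count (fun j => j < i)%N (nf t) | i <- nf s].

Lemma inversions_supp s t : inversions (supp s) (supp t) = inv_count s t.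
Proof.
rewrite /inversions /inv_count sumnE big_map.
rewrite -(big_supp s (fun i => count (fun j => j < i)%N (nf t))).
rewrite -sum1_card.
under [RHS]eq_bigr do
  rewrite -sum1_count big_mkcond -(big_supp t (fun j => if _ then _ else _)) -big_mkcondr.
by rewrite pair_big_dep; apply: eq_bigl => -[i j]; rewrite !inE andbA.
Qed.

Definition disj s t : bool := ~~ has (mem (nf s)) (nf t).

Lemma disjoint_supp s t : [disjoint supp s & supp t] = disj s t.
Proof.
apply/pred0P/hasPn => [st i | st i] /=.
  rewrite mem_nf => /andP[i_n it]; move: (st (Ordinal i_n)).
  by rewrite /= !inE mem_nf it andbT => ->; rewrite andbF.
apply/negP; rewrite !inE => /andP[si ti].
by move: (st i); rewrite /= !mem_nf ltn_ord ti /= [_ \in s]si => /(_ isT).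
Qed.

Lemma supp_cat s t : supp (s ++ t) = supp s :|: supp t.
Proof. by apply/setP=> i; rewrite !inE mem_cat. Qed.

Lemma wedge_monomial (S T : {set 'I_n}) :
  monomial k S \w monomial k T =
  if [disjoint S & T] then (-1) ^+ inversions S T *: monomial k (S :|: T) else 0.
Proof.
apply/ffunP=> U; rewrite ffunE.
(* Both sides become a sign times an indicator: at [U] only the index [S] contributes, paired with
   the complement [U :\: S], so it remains to match two Boolean conditions. *)
have -> : (if [disjoint S & T] then (-1) ^+ inversions S T *: monomial k (S :|: T)
           else 0) U
        = (-1) ^+ inversions S T * ([disjoint S & T] && (U == S :|: T))%:R :> k.
  by case: ifP => _; rewrite !ffunE ?mulr0.
rewrite big_mkcond (bigD1 S) //= big1 ?addr0 => [|V /negPf nSV]; last first.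
  by rewrite !ffunE nSV mul0r mulr0 if_same.
rewrite !ffunE eqxx mul1r.
have [SU | nSU] := boolP (S \subset U); last first.
  case: eqP nSU => [-> | _]; last by rewrite andbF mulr0.
  by rewrite finset.subsetUl.
have -> : ([disjoint S & T] && (U == S :|: T)) = (U :\: S == T).
  apply/andP/eqP => [[dST /eqP ->] | <-].
    rewrite finset.setDUl finset.setDv finset.set0U.
    by apply/finset.setDidPl; rewrite disjoint_sym.
  rewrite -{2}(finset.setID U S) (finset.setIidPr SU) eqxx; split=> //.
  by rewrite disjoint_sym finset.disjoints_subset finset.setDE finset.subsetIr.
by case: eqP => [->|] //; rewrite !mulr0.
Qed.

Lemma wedge_linearl b : linear (fun a => a \w b).
Proof.
move=> c a a'; apply/ffunP=> U; rewrite !ffunE scaler_sumr -big_split /=.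
apply: eq_bigr => S _; rewrite !ffunE mulrDl mulrDr -[c *: a S]/(c * a S).
by rewrite -[c *: (_ * _)]/(c * _) -mulrA mulrCA.
Qed.

Lemma wedge_linearr a : linear (wedge a).
Proof.
move=> c b b'; apply/ffunP=> U; rewrite !ffunE scaler_sumr -big_split /=.
apply: eq_bigr => S _; rewrite !ffunE mulrDr mulrDr -[c *: b _]/(c * b _).
congr (_ + _); rewrite -[RHS]/(c * ((-1) ^+ _ * (a S * b _))).
by rewrite (mulrCA (a S)) [RHS]mulrCA.
Qed.

HB.instance Definition _ a :=
  GRing.isLinear.Build k C C *:%R (wedge a) (wedge_linearr a).

(* Kept opaque to [cbv], so that only the combinatorics of exponents is computed. *)
Definition cadd (c d : k) : k := c + d.
Definition cmul (c d : k) : k := c * d.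
Definition copp (c : k) : k := - c.
Definition czero : k := 0.
Definition cone : k := 1.

(* [den l] encodes a sparse linear combination of monomials: [(c, s)] stands for
   [c] times the increasing monomial on the generators listed in [s], in which
   repetitions and entries [>= n] are ignored. *)
Definition den l : C := \sum_(p <- l) p.1 *: monomial k (supp p.2).

Definition coef l s : k :=
  foldr (fun p e => if nf p.2 == nf s then cadd p.1 e else e) czero l.

Lemma coefE l s : den l (supp s) = coef l s.
Proof.
rewrite /den sum_ffunE; elim: l => [|p l IH]; first by rewrite big_nil.
rewrite big_cons IH /= !ffunE eq_supp (eq_sym (nf s)).
by case: eqP => _; rewrite ?scaler0 ?add0r // -[p.1 *: 1]/(p.1 * 1) mulr1.
Qed.

Lemma coef_notin l s : nf s \notin [seq nf p.2 | p <- l] -> coef l s = 0.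
Proof.
elim: l => [//|p l IH] /=; rewrite inE negb_or eq_sym => /andP[/negPf -> /IH].
by [].
Qed.

(** Only the finitely many exponents listed on either side need checking; the nested conjunction
    unfolds by computation into scalar identities. *)
Definition coef_agree l l' : Prop :=
  foldr (fun p P => coef l p.2 = coef l' p.2 /\ P) True (l ++ l').

Lemma coef_agree_den l l' : coef_agree l l' -> den l = den l'.
Proof.
move=> ag; apply/ffunP=> S; rewrite -(supp_surj S) !coefE.
move: [seq val i | i <- enum S] => s.
have [/mapP[p pl sp] | ns] := boolP (nf s \in [seq nf p.2 | p <- l ++ l']).
  have cs m : coef m s = coef m p.2.
    by rewrite -!coefE -(supp_nf s) sp supp_nf.
  rewrite !cs.
  move: ag pl; rewrite /coef_agree; elim: (l ++ l') => [//|q m IH] /= [e ag].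
  by rewrite inE => /orP[/eqP -> | /(IH ag)].
by move: ns; rewrite map_cat mem_cat negb_or => /andP[? ?]; rewrite !coef_notin.
Qed.

Lemma denD l l' : den l + den l' = den (l ++ l').
Proof. by rewrite /den big_cat. Qed.

Definition lscale (c : k) l := [seq (cmul c p.1, p.2) | p <- l].

Lemma denZ c l : c *: den l = den (lscale c l).
Proof.
rewrite /den big_map scaler_sumr.
by apply: eq_bigr => p _; rewrite scalerA.
Qed.

Lemma denN l : - den l = den (lscale (copp cone) l).
Proof. by rewrite -denZ /copp scaleN1r. Qed.

Lemma den_nil : 0 = den [::].
Proof. by rewrite /den big_nil. Qed.

Definition lsign (m : nat) (c : k) : k := if odd m then copp c else c.

Lemma lsignE m c : lsign m c = (-1) ^+ m * c.
Proof. by rewrite /lsign -signr_odd; case: odd; rewrite ?mulN1r ?mul1r. Qed.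

(** Exponents are concatenated without sorting: [den] ignores their order, and the sign of the
    sorting permutation goes into the coefficient. *)
Definition lwedge l l' : seq (k * seq nat) :=
  flatten [seq [seq (lsign (inv_count p.2 q.2) (cmul p.1 q.1), p.2 ++ q.2)
               | q <- l' & disj p.2 q.2] | p <- l].

Lemma denM l l' : den l \w den l' = den (lwedge l l').
Proof.
rewrite /lwedge /den big_flatten big_map /=.
(* The declared linear structure concerns the right factor; the one in the left factor is packed
   locally. *)
pose f := GRing.isLinear.Build k C C *:%R (fun a => a \w den l') (wedge_linearl _).
pose g : {linear C -> C} := HB.pack (fun a => a \w den l') f.
rewrite -[LHS]/(g _) linear_sum; apply: eq_bigr => p _; rewrite linearZ /= /den.
rewrite linear_sum scaler_sumr big_map big_filter [RHS]big_mkcond.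
apply: eq_bigr => q _; rewrite linearZ /= wedge_monomial disjoint_supp.
case: ifP => _; last by rewrite !scaler0.
by rewrite lsignE supp_cat inversions_supp !scalerA mulrC.
Qed.

Definition ldeg (m : nat) l := all (fun p => size (nf p.2) == m) l.

Lemma ext_deg_den m l : ldeg m l -> ext_deg m (den l).
Proof.
move=> dl S; rewrite -(supp_surj S) card_supp; move: [seq _ | _ <- _] => s.
rewrite coefE; case: (boolP (nf s \in [seq nf p.2 | p <- l])); last first.
  by move/coef_notin ->; rewrite eqxx.
by case/mapP=> p pl ->; move/allP: dl => /(_ p pl)/eqP.
Qed.

Fixpoint subseqs s : seq (seq nat) :=
  if s is i :: r then [seq i :: t | t <- subseqs r] ++ subseqs r else [:: [::]].

Lemma mem_subseqs s (P : pred nat) : filter P s \in subseqs s.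
Proof.
elim: s => //= i s IH; rewrite mem_cat; case: (P i); last by rewrite IH orbT.
by rewrite map_f.
Qed.

Definition expand (L : seq (seq nat)) (f : seq nat -> k) := [seq (f s, s) | s <- L].

(** Turns an arbitrary element into a sparse combination with unknown coefficients, on which
    products and differentials can be computed. Distinct normal forms in [L] prevent a coefficient
    from being counted twice. *)
Lemma den_expand L a : uniq (map nf L) ->
  (forall s, a (supp s) != 0 -> nf s \in map nf L) ->
  a = den (expand L (fun s => a (supp s))).
Proof.
move=> uL aL; apply/ffunP=> S; rewrite -(supp_surj S).
move: [seq _ | _ <- _] => s; rewrite coefE.
have [/mapP[t tL st]|ns] := boolP (nf s \in map nf L); last first.
  rewrite coef_notin -?map_comp //.
  by apply/eqP/negbNE/negP => /aL; rewrite (negPf ns).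
move/eqP: (st); rewrite -eq_supp => /eqP ->.
have ->: coef (expand L (fun s => a (supp s))) s =
         coef (expand L (fun s => a (supp s))) t by rewrite /coef -st.
elim: L uL tL {aL} => //= r L IH /andP[rL uL]; rewrite inE.
have [-> _ /=| nrt /=] := eqVneq t r.
  rewrite eqxx coef_notin -?map_comp //.
  by rewrite /cadd addr0.
move=> tL; case: eqP => [rt|_].
  by case/mapP: rL; exists t.
exact: IH.
Qed.

Lemma mem_subseqs_nf s : nf s \in subseqs (iota 0 n).
Proof. exact: mem_subseqs. Qed.

End Sparse.

(** * Bilinearity, unit and homogeneous components *)

Lemma wedge0l (k : fieldType) n (a : ext k n) : 0 \w a = 0.
Proof.
apply/ffunP => U; rewrite !ffunE big1 // => S _.
by rewrite ffunE mul0r mulr0.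
Qed.

Lemma wedge0r (k : fieldType) n (a : ext k n) : a \w 0 = 0.
Proof. exact: linear0. Qed.

Lemma wedgeDl (k : fieldType) n (c : ext k n) : {morph (fun a => a \w c) : a b / a + b}.
Proof. by move=> a b; have := wedge_linearl c 1 a b; rewrite !scale1r. Qed.

Lemma wedgeZl (k : fieldType) n (r : k) (a b : ext k n) : (r *: a) \w b = r *: (a \w b).
Proof. by have := wedge_linearl b r a 0; rewrite wedge0l !addr0. Qed.

Lemma wedge1r (k : fieldType) n (a : ext k n) : a \w monomial k finset.set0 = a.
Proof.
apply/ffunP=> U; rewrite ffunE (bigD1 U) //= finset.setDv big1 ?addr0.
  rewrite ffunE eqxx mulr1 /inversions (_ : finset _ = finset.set0) ?cards0 ?mul1r //.
  by apply/setP=> q; rewrite !inE andbF.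
move=> S /andP[SU nSU]; rewrite ffunE; case: eqP => [/eqP|_]; last by rewrite !mulr0.
by rewrite finset.setD_eq0 => US; rewrite finset.eqEsubset SU US in nSU.
Qed.

Lemma ext_compE (k : fieldType) n (m q : nat) (a : ext k n) :
  ext_deg m a -> ext_comp q a = if q == m then a else 0.
Proof.
move=> am; apply/ffunP=> S; rewrite ffunE.
have [aS|/negPn/eqP aS] := boolP (a S != 0).
  by rewrite (am S aS) eq_sym; case: ifP => // _; rewrite ffunE.
by case: (q == m); rewrite ?ffunE aS if_same.
Qed.

(** * The complex on [v], [w], [x], [y], [z] *)

Ltac den_compute :=
  cbv -[cadd cmul copp czero cone GRing.Field.sort];
  rewrite /cadd /cmul /copp /czero /cone.

Ltac den_ring :=
  apply: coef_agree_den; den_compute; do ?split; try ring.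

Section Cochains.
Variable k : fieldType.
Local Notation C := (ext k 5).
Implicit Types (a b c : C) (l : seq (k * seq nat)).

(** For homogeneous [b] and [c] a single pair of components survives in the double sum, so the
    Koszul sign becomes a constant. *)
Lemma triv_m3_deg (i : C -> C) (p q : nat) a b c :
  i 0 = 0 -> (p < 6)%N -> (q < 6)%N -> ext_deg p b -> ext_deg q c ->
  triv_m3 i a b c =
  i (a \w b \w c) - i (a \w b) \w c - (-1) ^+ (p * q) *: (i (a \w c) \w b)
  - a \w i (b \w c) + i a \w b \w c + a \w i b \w c + a \w b \w i c.
Proof.
move=> i0 p6 q6 bp cq; rewrite /triv_m3; do 5 congr (_ + _); congr (- _).
rewrite (bigD1 (Ordinal p6)) //= [X in _ + X]big1 ?addr0 => [|s sp]; last first.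
  apply: big1 => t _; rewrite (ext_compE s bp) ifN ?wedge0r ?scaler0 //.
rewrite (bigD1 (Ordinal q6)) //= [X in _ + X]big1 ?addr0 => [|t tq]; last first.
  by rewrite (ext_compE t cq) ifN // wedge0r i0 wedge0l scaler0.
by rewrite (ext_compE _ bp) (ext_compE _ cq) !eqxx.
Qed.

Lemma contr0 : contr (0 : C) = 0.
Proof. by rewrite /contr ffunE scale0r. Qed.

Lemma ext_gen_den (g : 'I_5) : ext_gen k g = den 5 [:: (cone k, [:: val g])].
Proof.
rewrite /den big_seq1 scale1r /ext_gen; congr monomial.
by apply/setP=> h; rewrite !inE.
Qed.

(** Exponents 0, 1, 2, 3, 4 stand for [v], [w], [x], [y], [z]; the map reads the coefficient of
    [vwx] and returns that multiple of [y]. *)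
Lemma contr_den l :
  contr (den 5 l) = den 5 [:: (coef 5 l [:: 0; 1; 2]%N, [:: 3%N])].
Proof.
rewrite /contr.
have -> : ([set iv; iw; ix])%SET = supp 5 [:: 0; 1; 2]%N.
  by apply/setP=> h; rewrite !inE -!val_eqE /= orbA.
by rewrite /gy ext_gen_den denZ /= /cmul /cone mulr1 coefE.
Qed.

(** Since [z] is the last generator and the only one that is not closed, [d(m z)] is
    [(-1)^|m| m xy], and monomials without [z] are closed. *)
Definition ldiff l : seq (k * seq nat) :=
  lwedge 5
    [seq (lsign (size (nf 5 [seq i <- p.2 | (i < 4)%N])) p.1,
          [seq i <- p.2 | (i < 4)%N]) | p <- l & 4%N \in p.2]
    [:: (cone k, [:: 2; 3]%N)].


Lemma gxy_den : gx k \w gy k = den 5 [:: (cone k, [:: 2; 3]%N)].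
Proof. rewrite /gx /gy !ext_gen_den denM; den_ring. Qed.

Lemma ce_diff_den l : ce_diff k (den 5 l) = den 5 (ldiff l).
Proof.
rewrite /ldiff -denM -gxy_den {1}/den linear_sum /=.
rewrite /den big_map (big_morph _ (wedgeDl _) (wedge0l _)) big_filter [RHS]big_mkcond.
apply: eq_bigr => p _; rewrite linearZ /= /derivation (bigD1 (supp 5 p.2)) //=.
rewrite [X in _ *: (_ + X)]big1 ?addr0 => [|S /negPf nS]; last first.
  by rewrite ffunE nS scale0r.
rewrite ffunE eqxx scale1r.
case: ifP => z_p; last first.
  rewrite big1 ?scaler0 // => g; rewrite inE /ce_diff_gen.
  by case: eqP => [->|_ _]; rewrite ?[val _ \in _]z_p // wedge0r wedge0l scaler0.
rewrite (bigD1 iz) ?inE //= big1 ?addr0 => [|g /andP[_ /negPf giz]]; last first.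
  by rewrite /ce_diff_gen giz wedge0r wedge0l scaler0.
have -> : ([set h in supp 5 p.2 | (h < iz)%N])%SET = supp 5 [seq i <- p.2 | (i < 4)%N].
  by apply/setP=> h; rewrite !inE mem_filter andbC.
(* No generator follows [z], so the factor to its right is the unit. *)
have -> : ([set h in supp 5 p.2 | (iz < h)%N])%SET = supp 5 [::].
  by apply/setP=> h; rewrite !inE andbC ltnNge -ltnS ltn_ord.
rewrite /ce_diff_gen eqxx card_supp lsignE.
have -> : supp 5 [::] = finset.set0 by apply/setP=> h; rewrite !inE.
by rewrite wedge1r wedgeZl scalerA mulrC.
Qed.

Definition mons (m : nat) : seq (seq nat) :=
  [seq s <- subseqs (iota 0 5) | size s == m].

Lemma ext_deg_expand (m : nat) a :
  ext_deg m a -> exists f, a = den 5 (expand (mons m) f).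
Proof.
move=> am; exists (fun s => a (supp 5 s)).
have nfL : map (nf 5) (mons m) = mons m.
  apply/eqP; rewrite -[X in _ == X]map_id; apply/eqP/eq_in_map => s.
  rewrite mem_filter => /andP[_].
  have: all (fun s => nf 5 s == s) (subseqs (iota 0 5)) by [].
  by move/allP=> h /h/eqP.
apply: den_expand; first by rewrite nfL filter_uniq.
move=> s /am; rewrite card_supp => sm.
by rewrite nfL mem_filter sm eqxx mem_subseqs_nf.
Qed.

Lemma ce_diffE a : exists c1 c2 c3 c4 : k, ce_diff k a =
  den 5 [:: (c1, [:: 2; 3]); (c2, [:: 0; 2; 3]); (c3, [:: 1; 2; 3]);
            (c4, [:: 0; 1; 2; 3])]%N.
Proof.
have [f ->] : exists f, a = den 5 (expand (subseqs (iota 0 5)) f).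
  exists (fun s => a (supp 5 s)); apply: den_expand => // s _.
  rewrite (_ : map _ _ = subseqs (iota 0 5)) ?mem_subseqs_nf //.
(* These are the coefficients of [z], [vz], [wz], [vwz]; any other monomial with [z] contains [x] or
   [y], hence is killed by [xy]. *)
exists (f [:: 4%N]), (copp (f [:: 0; 4]%N)), (copp (f [:: 1; 4]%N)), (f [:: 0; 1; 4]%N).
rewrite ce_diff_den; den_ring.
Qed.

Lemma den_coef s l l' : den 5 l = den 5 l' -> coef 5 l s = coef 5 l' s.
Proof. by rewrite -!coefE => ->. Qed.

Lemma cocycle_deg1 a : ext_deg 1 a -> ce_diff k a = 0 ->
  exists f0 f1 f2 f3 : k,
    a = den 5 [:: (f0, [:: 0]); (f1, [:: 1]); (f2, [:: 2]); (f3, [:: 3])]%N.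
Proof.
move=> /ext_deg_expand[f ->]; rewrite ce_diff_den (den_nil _ 5) => da.
exists (f [:: 0%N]), (f [:: 1%N]), (f [:: 2%N]), (f [:: 3%N]).
have f4 : f [:: 4%N] = 0.
  by move: (den_coef [:: 2; 3]%N da); den_compute => f4; rewrite -[RHS]f4; ring.
den_ring; by rewrite f4; ring.
Qed.

(** The differentials of [vz] and [wz] are [- vxy] and [- wxy], and all other quadratic monomials
    are closed; the two coefficients are read off at [vxy] and [wxy]. *)
Lemma cocycle_deg2 a : ext_deg 2 a -> ce_diff k a = 0 ->
  exists f, a = den 5 (expand (mons 2) f) /\ f [:: 0; 4]%N = 0 /\ f [:: 1; 4]%N = 0.
Proof.
move=> /ext_deg_expand[f ->]; rewrite ce_diff_den (den_nil _ 5) => da.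
exists f; split=> //; split.
  by move: (den_coef [:: 0; 2; 3]%N da); den_compute => f4;
     apply: oppr_inj; rewrite oppr0 -[RHS]f4; ring.
by move: (den_coef [:: 1; 2; 3]%N da); den_compute => f4;
     apply: oppr_inj; rewrite oppr0 -[RHS]f4; ring.
Qed.

(** * Cohomology classes through their coefficients *)

Local Notation A := (ce_hycom k).

Lemma ce_homogE (m : nat) a : ce_homog (- m%:Z) a <-> ext_deg m a.
Proof.
split=> am S /am; last by move=> ->.
by move/oppr_inj => [].
Qed.

(** Boundaries are supported on [xy], [vxy], [wxy], [vwxy], so every other coefficient is an
    invariant of the class. *)
Lemma hclass_coef (a b : A) s :
  nf 5 s \notin [:: [:: 2; 3]; [:: 0; 2; 3]; [:: 1; 2; 3]; [:: 0; 1; 2; 3]]%N ->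
  hclass a = hclass b -> a (supp 5 s) = b (supp 5 s).
Proof.
move=> ns /hclass_eq[e]; have [c1 [c2 [c3 [c4 ->]]]] := ce_diffE e.
move/ffunP/(_ (supp 5 s)); rewrite coefE coef_notin // !ffunE.
by move/eqP; rewrite subr_eq0 => /eqP.
Qed.

Lemma ext_deg_eq0 m a s : ext_deg m a -> size (nf 5 s) != m -> a (supp 5 s) = 0.
Proof. by move=> am; rewrite -card_supp; apply: contra_neq_eq => /am. Qed.

Lemma hclass_deg1 (a b : A) :
  ext_deg 1 a -> ext_deg 1 b -> hclass a = hclass b -> a = b.
Proof.
move=> a1 b1 /hclass_coef ab; apply/ffunP=> S; rewrite -(supp_surj S).
move: [seq _ | _ <- _] => s; have [s1|s1] := eqVneq (size (nf 5 s)) 1%N.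
  by apply: ab; case: (nf 5 s) s1 => [|? []] // _; rewrite !inE !eqseq_cons !andbF.
by rewrite !(ext_deg_eq0 _ s1).
Qed.

Lemma hclass_deg2 (a b : A) :
  ext_deg 2 a -> ext_deg 2 b -> hclass a = hclass b ->
  exists r : k, a = b + den 5 [:: (r, [:: 2; 3]%N)].
Proof.
move=> a2 b2 /hclass_coef ab; exists (a (supp 5 [:: 2; 3]%N) - b (supp 5 [:: 2; 3]%N)).
apply/ffunP=> S; rewrite -(supp_surj S).
move: [seq _ | _ <- _] => s; rewrite ffunE coefE.
have [s2|s2] := eqVneq (nf 5 s) (nf 5 [:: 2; 3]%N).
  have -> : supp 5 s = supp 5 [:: 2; 3]%N by apply/eqP; rewrite eq_supp s2.
  by rewrite /coef /= s2 eqxx /cadd /czero addr0 addrC subrK.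
rewrite coef_notin ?addr0 ?inE //; have [s1|s1] := eqVneq (size (nf 5 s)) 2%N.
  apply: ab; move: s2 s1; case: (nf 5 s) => [|? [|? []]] //.
  by rewrite in_cons negb_or => -> _; rewrite !inE !eqseq_cons !andbF.
by rewrite !(ext_deg_eq0 _ s1).
Qed.

Lemma hclass_ce_diff (a : A) : hclass (A := A) (ce_diff k a) = 0.
Proof. by rewrite -(hclass0 A); apply/hclass_eq; exists a; rewrite subr0. Qed.

(* The cocycles whose classes form the indeterminacy; [vxy] and [wxy] bound. *)
Definition indet_cocycle a : Prop := exists r1 r2 r3 r4 r5 : k, a = den 5
  [:: (r1, [:: 0; 1; 2]); (r2, [:: 0; 1; 3]); (r3, [:: 2; 3; 4]);
      (r4, [:: 0; 2; 3]); (r5, [:: 1; 2; 3])]%N.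

Lemma indet_cocycleD a b : indet_cocycle a -> indet_cocycle b -> indet_cocycle (a + b).
Proof.
move=> [r1 [r2 [r3 [r4 [r5 ->]]]]] [s1 [s2 [s3 [s4 [s5 ->]]]]].
exists (cadd r1 s1), (cadd r2 s2), (cadd r3 s3), (cadd r4 s4), (cadd r5 s5).
rewrite denD; den_ring.
Qed.

Lemma indet_cocycleN a : indet_cocycle a -> indet_cocycle (- a).
Proof.
move=> [r1 [r2 [r3 [r4 [r5 ->]]]]].
exists (copp r1), (copp r2), (copp r3), (copp r4), (copp r5).
rewrite denN; den_ring.
Qed.

Lemma indet_cocycle0 : indet_cocycle 0.
Proof.
exists (czero k), (czero k), (czero k), (czero k), (czero k).
rewrite (den_nil k 5); den_ring.
Qed.

(** The last two terms come from [vz] and [wz], absent from cocycles; the others have the shape of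
    [indet_cocycle], with a zero entered for [vwy]. *)
Lemma wedge_gx f : den 5 (expand (mons 2) f) \w gx k = den 5
  [:: (f [:: 0; 1], [:: 0; 1; 2]); (czero k, [:: 0; 1; 3]); (f [:: 3; 4], [:: 2; 3; 4]);
      (copp (f [:: 0; 3]), [:: 0; 2; 3]); (copp (f [:: 1; 3]), [:: 1; 2; 3]);
      (copp (f [:: 0; 4]), [:: 0; 2; 4]); (copp (f [:: 1; 4]), [:: 1; 2; 4])]%N.
Proof. rewrite /gx ext_gen_den denM; den_ring. Qed.

(* [r xy = d (r z)] is the general boundary of degree 2. *)
Definition rep_vw (r : k) : C := gv k \w gw k + den 5 [:: (r, [:: 2; 3]%N)].
Definition rep_vx (r : k) : C := gv k \w gx k + den 5 [:: (r, [:: 2; 3]%N)].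

(** * Values of the operations on the representatives *)

Lemma rep_vwE r : rep_vw r = den 5 [:: (cone k, [:: 0; 1]); (r, [:: 2; 3])]%N.
Proof. rewrite /rep_vw /gv /gw !ext_gen_den denM denD; den_ring. Qed.

Lemma rep_vxE r : rep_vx r = den 5 [:: (cone k, [:: 0; 2]); (r, [:: 2; 3])]%N.
Proof. rewrite /rep_vx /gv /gx !ext_gen_den denM denD; den_ring. Qed.

(** With [a = vw + r xy] and [b] the generic 2-cochain, two terms survive: [- i(a x) b = - y b] and
    [- a i(b x)]. Each contributes one copy of the coefficient of [vw] to [vwy]; the terms in [vyz]
    and [wyz] vanish on cocycles. *)
Lemma m3_cochain r f : triv_m3 (@contr k) (rep_vw r) (den 5 (expand (mons 2) f)) (gx k)
  = den 5 [:: (copp (cadd (f [:: 0; 1]) (f [:: 0; 1])), [:: 0; 1; 3]);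
              (f [:: 2; 4], [:: 2; 3; 4]);
              (copp (f [:: 0; 2]), [:: 0; 2; 3]); (copp (f [:: 1; 2]), [:: 1; 2; 3]);
              (f [:: 0; 4], [:: 0; 3; 4]); (f [:: 1; 4], [:: 1; 3; 4])]%N.
Proof.
rewrite rep_vwE /gx ext_gen_den.
rewrite (@triv_m3_deg _ 2 1) ?contr0 //; try exact: ext_deg_den.
rewrite -signr_odd expr0 scale1r.
rewrite !(denM, contr_den, denZ, denN, denD).
den_ring.
Qed.

(** The terms with [i(a x)] vanish by degree, the others because [x x = 0] or [i(x) = 0]. *)
Lemma m3_gx_gx a : ext_deg 3 a -> triv_m3 (@contr k) a (gx k) (gx k) = 0.
Proof.
move=> /ext_deg_expand[f ->]; rewrite /gx ext_gen_den.
rewrite (@triv_m3_deg _ 1 1) ?contr0 //; try exact: ext_deg_den.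
rewrite -signr_odd expr1 scaleN1r !(denM, contr_den, denN, denD) (den_nil _ 5).
den_ring.
Qed.

Lemma m3_rep_vx_gx_gx r : triv_m3 (@contr k) (rep_vx r) (gx k) (gx k) = 0.
Proof.
rewrite rep_vxE /gx ext_gen_den.
rewrite (@triv_m3_deg _ 1 1) ?contr0 //; try exact: ext_deg_den.
rewrite -signr_odd expr1 scaleN1r !(denM, contr_den, denN, denD) (den_nil _ 5).
den_ring.
Qed.

(** Only [- i(vwx) (vx + r' xy)] survives, and [y] kills [xy], so neither parameter enters the
    value. *)
Lemma m3_rep_vw_rep_vx_gx r r' :
  triv_m3 (@contr k) (rep_vw r) (rep_vx r') (gx k) =
  ce_diff k (gv k \w gz k).
Proof.
rewrite rep_vwE rep_vxE /gx /gv /gz !ext_gen_den denM ce_diff_den.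
rewrite (@triv_m3_deg _ 2 1) ?contr0 //; try exact: ext_deg_den.
rewrite -signr_odd expr0 scale1r !(denM, contr_den, denN, denD).
den_ring.
Qed.

Lemma wedge_rep_vw_rep_vx r r' :
  rep_vw r \w rep_vx r' = ce_diff k (den 5 [:: (r', [:: 0; 1; 4])])%N.
Proof. rewrite rep_vwE rep_vxE denM ce_diff_den; den_ring. Qed.

Lemma wedge_rep_vx_gx r : rep_vx r \w gx k = 0.
Proof. rewrite rep_vxE /gx ext_gen_den denM (den_nil _ 5); den_ring. Qed.

Lemma wedge_rep_vw r (f0 f1 f2 f3 : k) :
  rep_vw r \w den 5 [:: (f0, [:: 0]); (f1, [:: 1]); (f2, [:: 2]); (f3, [:: 3])]%N =
  den 5 [:: (f2, [:: 0; 1; 2]); (f3, [:: 0; 1; 3]); (czero k, [:: 2; 3; 4]);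
            (cmul r f0, [:: 0; 2; 3]); (cmul r f1, [:: 1; 2; 3])]%N.
Proof. rewrite rep_vwE denM; den_ring. Qed.

Lemma wedge_gv_gz_gx : gv k \w gz k \w gx k = - (gv k \w (gx k \w gz k)).
Proof. rewrite /gv /gx /gz !ext_gen_den !denM denN; den_ring. Qed.

Lemma gvxzE : gv k \w (gx k \w gz k) = den 5 [:: (cone k, [:: 0; 2; 4])]%N.
Proof. rewrite /gv /gx /gz !ext_gen_den !denM; den_ring. Qed.

Lemma indet_coset_cycle a : indet_cocycle a ->
  cycles (A := A) (- 3) (gv k \w (gx k \w gz k) + a).
Proof.
move=> [r1 [r2 [r3 [r4 [r5 ->]]]]]; rewrite gvxzE denD; split=> /=.
  by apply/(ce_homogE 3)/ext_deg_den.
rewrite ce_diff_den (den_nil k 5); den_ring.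
Qed.

Lemma hclass_indet_neq0 a : indet_cocycle a ->
  hclass (A := A) (gv k \w (gx k \w gz k) + a) <> 0.
Proof.
move=> [r1 [r2 [r3 [r4 [r5 ->]]]]]; rewrite -(hclass0 A) gvxzE denD (den_nil k 5).
(* The invariant used is the coefficient of [vxz], which is 1 on this coset and 0 on the zero
   class. *)
move=> /(@hclass_coef _ _ [:: 0; 2; 4]%N) => /(_ isT); rewrite !coefE.
den_compute; rewrite addr0 => /eqP; exact/negP/oner_neq0.
Qed.

(** * The Künneth summand *)

Lemma heis_cocycle2 b : heis_cocycles 2 b -> exists p q r : k,
  b = den 5 [:: (p, [:: 2; 3]); (q, [:: 2; 4]); (r, [:: 3; 4])]%N.
Proof.
move=> [bS b2 _]; pose L := [:: [:: 2; 3]; [:: 2; 4]; [:: 3; 4]]%N.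
exists (b (supp 5 [:: 2; 3]%N)), (b (supp 5 [:: 2; 4]%N)), (b (supp 5 [:: 3; 4]%N)).
apply: (@den_expand k 5 L) => // s bs.
have := b2 _ bs; rewrite card_supp => s2.
have s_xyz : all (leq 2) (nf 5 s).
  apply/allP=> i; rewrite mem_nf => /andP[i5 si].
  have /fintype.subsetP/(_ (Ordinal i5)) := bS _ bs.
  by rewrite inE => /(_ si)/set_mem[[|]|] /(congr1 val) /= ->.
(* A finite check over the 32 monomials: a pair of exponents that are all at least 2 is one of the
   three in [L]. *)
have: all (fun t => [&& size t == 2%N & all (leq 2) t] ==> (t \in map (nf 5) L))
        (subseqs (iota 0 5)) by [].
by move=> /allP/(_ _ (mem_subseqs_nf 5 s)); rewrite s2 s_xyz.
Qed.

(** Monomials of the Künneth summand contain exactly one of [v] and [w], so the invariant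
    coefficients of [vwx], [vwy] and [xyz] vanish; what remains of [a] is a boundary. *)
Lemma indet_kunneth a : indet_cocycle a ->
  kunneth_1_2 (hclass (A := A) (gv k \w (gx k \w gz k) + a)) ->
  hclass (A := A) (gv k \w (gx k \w gz k) + a) = hclass (A := A) (gv k \w (gx k \w gz k)).
Proof.
move=> [r1 [r2 [r3 [r4 [r5 ->]]]]] [b1 [b2 [/heis_cocycle2[p1 [q1 [t1 ->]]]]]].
move=> /heis_cocycle2[p2 [q2 [t2 ->]]].
rewrite gvxzE /gv /gw !ext_gen_den !denM !denD => /hclass_coef e.
have r1_0 : r1 = 0.
  by move: (e [:: 0; 1; 2]%N isT); rewrite !coefE; den_compute; rewrite addr0.
have r2_0 : r2 = 0.
  by move: (e [:: 0; 1; 3]%N isT); rewrite !coefE; den_compute; rewrite addr0.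
have r3_0 : r3 = 0.
  by move: (e [:: 2; 3; 4]%N isT); rewrite !coefE; den_compute; rewrite addr0.
apply/hclass_eq; exists (den 5 [:: (copp r4, [:: 0; 4]); (copp r5, [:: 1; 4])]%N).
rewrite [RHS]ce_diff_den denN denD r1_0 r2_0 r3_0 -/(czero k); den_ring.
Qed.

Lemma kunneth_gvxz : kunneth_1_2 (hclass (A := A) (gv k \w (gx k \w gz k))).
Proof.
exists (gx k \w gz k), 0; split; last by rewrite wedge0r addr0.
  split=> [S||]; rewrite /gx /gz !ext_gen_den denM.
  - rewrite /lwedge /= /den big_seq1 !ffunE /=.
    have [->|_] := eqVneq S (supp 5 [:: 2; 4]%N); last by rewrite scaler0 eqxx.
    move=> _; apply/fintype.subsetP=> i i_xz; apply: mem_set.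
    move: i_xz; rewrite !inE => /orP[]/eqP ei.
      by left; left; apply: val_inj.
    by right; apply: val_inj.
  - exact: ext_deg_den.
  rewrite ce_diff_den (den_nil k 5); den_ring.
split=> [S|S|]; last exact: linear0.
  by rewrite ffunE eqxx.
by rewrite ffunE eqxx.
Qed.

End Cochains.

(** * The summands of [Gamma] *)

Local Notation o0 := (@Ordinal 4 0 isT).
Local Notation o1 := (@Ordinal 4 1 isT).
Local Notation o2 := (@Ordinal 4 2 isT).
Local Notation o3 := (@Ordinal 4 3 isT).

Lemma enum_ord4 : enum 'I_4 = [:: o0; o1; o2; o3].
Proof. by apply: (inj_map val_inj); rewrite val_enum_ord. Qed.

Lemma permuted1 (T : Type) (y0 y1 y2 y3 : T) :
  permuted 1%g [tuple y0; y1; y2; y3] = [:: y0; y1; y2; y3].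
Proof. by rewrite /permuted enum_ord4 /= !invg1 !perm1. Qed.

Lemma permuted34 (T : Type) (y0 y1 y2 y3 : T) :
  permuted perm34 [tuple y0; y1; y2; y3] = [:: y0; y1; y3; y2].
Proof. by rewrite /permuted enum_ord4 /= !tpermV !permE. Qed.

Section Terms.
Variable k : fieldType.
Local Notation A := (ce_hycom k).
Implicit Types (y u : A).
Variables (y0 y1 y2 y3 : A).
Let y : 4.-tuple A := [tuple y0; y1; y2; y3].

Lemma inner_val0 : inner_val (tnth (Gamma k) o0) y = y0 \w y1.
Proof. by rewrite /inner_val /inner_args permuted1. Qed.

Lemma inner_val1 : inner_val (tnth (Gamma k) o1) y = triv_m3 (@contr k) y0 y1 y3.
Proof. by rewrite /inner_val /inner_args permuted34. Qed.

Lemma inner_val2 : inner_val (tnth (Gamma k) o2) y = y1 \w y2.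
Proof. by rewrite /inner_val /inner_args permuted1. Qed.

Lemma inner_val3 : inner_val (tnth (Gamma k) o3) y = triv_m3 (@contr k) y1 y2 y3.
Proof. by rewrite /inner_val /inner_args permuted1. Qed.

Lemma outer_val0 u : outer_val (tnth (Gamma k) o0) y u = triv_m3 (@contr k) u y2 y3.
Proof. by rewrite /outer_val /outer_args permuted1 /= scale1r. Qed.

Lemma outer_val1 u : outer_val (tnth (Gamma k) o1) y u = u \w y2.
Proof. by rewrite /outer_val /outer_args permuted34 /= scale1r. Qed.

Lemma outer_val2 u : outer_val (tnth (Gamma k) o2) y u = - triv_m3 (@contr k) y0 u y3.
Proof. by rewrite /outer_val /outer_args permuted1 /= scaleN1r. Qed.

Lemma outer_val3 u : outer_val (tnth (Gamma k) o3) y u = - (y0 \w u).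
Proof. by rewrite /outer_val /outer_args permuted1 /= scaleN1r. Qed.

Let degs : 4.-tuple int := [tuple (- 2); (- 2); (- 1); (- 1)].

Lemma rho_deg0 : rho_deg (tnth (Gamma k) o0) degs = - 3%:Z.
Proof. by rewrite /rho_deg /inner_args permuted1 /= !big_cons big_nil. Qed.

Lemma rho_deg1 : rho_deg (tnth (Gamma k) o1) degs = - 2%:Z.
Proof. by rewrite /rho_deg /inner_args permuted34 /= !big_cons big_nil. Qed.

Lemma rho_deg2 : rho_deg (tnth (Gamma k) o2) degs = - 2%:Z.
Proof. by rewrite /rho_deg /inner_args permuted1 /= !big_cons big_nil. Qed.

Lemma rho_deg3 : rho_deg (tnth (Gamma k) o3) degs = - 1%:Z.
Proof. by rewrite /rho_deg /inner_args permuted1 /= !big_cons big_nil. Qed.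

Lemma koszul_exp1 (t : qterm k hycom 4) n : qperm t = 1%g -> koszul_exp t n = 0.
Proof.
move=> t1; rewrite /koszul_exp big1 // => i _; rewrite big_pred0 // => j.
by rewrite t1 !perm1; case: ltngtP.
Qed.

(** The only inversion is the pair of the last two classes, both of degree -1, contributing
    [(-1)(-1)]. *)
Lemma koszul_exp34 : koszul_exp (tnth (Gamma k) o1) degs = 1.
Proof.
rewrite /koszul_exp; under eq_bigr do rewrite big_mkcond /=.
rewrite !big_ord_recl !big_ord0 /=.
by rewrite !(add0r, addr0) !(tnth_nth 0) !permE.
Qed.

Lemma massey_exp0 : massey_exp (tnth (Gamma k) o0) degs = 2.
Proof. by rewrite /massey_exp koszul_exp1 // permuted1 /= !big_nil. Qed.

(** The only odd exponent of the four: it turns [(vz) x] into [- (vz) x = vxz]. *)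
Lemma massey_exp1 : massey_exp (tnth (Gamma k) o1) degs = 1.
Proof. by rewrite /massey_exp koszul_exp34 permuted34 /= !big_nil. Qed.

Lemma massey_exp2 : massey_exp (tnth (Gamma k) o2) degs = 4.
Proof. by rewrite /massey_exp koszul_exp1 // permuted1 /= !big_cons !big_nil. Qed.

Lemma massey_exp3 : massey_exp (tnth (Gamma k) o3) degs = - 2.
Proof. by rewrite /massey_exp koszul_exp1 // permuted1 /= !big_cons !big_nil. Qed.

End Terms.

Lemma ext_degB (k : fieldType) n (m : nat) (a b : ext k n) :
  ext_deg m a -> ext_deg m b -> ext_deg m (a - b).
Proof.
move=> am bm S; rewrite !ffunE; apply: contra_neq_eq => Sm.
have -> : a S = 0 by apply: contra_neq_eq Sm => /am.
by rewrite add0r; apply/eqP; rewrite oppr_eq0; apply: contraNT Sm => /bm ->.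
Qed.

Lemma forall_ord4 (P : 'I_4 -> Prop) :
  P o0 -> P o1 -> P o2 -> P o3 -> forall j, P j.
Proof.
move=> p0 p1 p2 p3 [[|[|[|[|//]]]] j4].
- by rewrite (bool_irrelevance j4 isT).
- by rewrite (bool_irrelevance j4 isT).
- by rewrite (bool_irrelevance j4 isT).
by rewrite (bool_irrelevance j4 isT).
Qed.

Lemma sum_ord4 (V : nmodType) (F : 'I_4 -> V) : \sum_(j < 4) F j =
  F o0 + F o1 + F o2 + F o3.
Proof.
by rewrite -big_enum enum_ord4 /= !big_cons big_nil addr0 !addrA.
Qed.

(** * The Massey product *)

Section Main.
Variable k : fieldType.
Local Notation A := (ce_hycom k).
Local Notation v := (gv k). Local Notation w := (gw k).
Local Notation x := (gx k). Local Notation z := (gz k).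
Let degs : 4.-tuple int := [tuple (- 2); (- 2); (- 1); (- 1)].
Let classes : 4.-tuple (homology A) :=
    [tuple hclass (A := A) (v \w w); hclass (A := A) (v \w x);
           hclass (A := A) x; hclass (A := A) x].

Definition reps (r s : k) : 4.-tuple A :=
  [tuple rep_vw r : A; rep_vx s : A; x : A; x : A].

Lemma ext_deg_rep_vw (r : k) : ext_deg 2 (rep_vw r).
Proof. by rewrite rep_vwE; apply: ext_deg_den. Qed.

Lemma ext_deg_rep_vx (r : k) : ext_deg 2 (rep_vx r).
Proof. by rewrite rep_vxE; apply: ext_deg_den. Qed.

Lemma ext_deg_gx : ext_deg 1 x.
Proof. by rewrite /gx ext_gen_den; apply: ext_deg_den. Qed.

Lemma hclass_rep (b : A) (r : k) :
  hclass (A := A) (b + den 5 [:: (r, [:: 2; 3]%N)]) = hclass (A := A) b.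
Proof.
apply/hclass_eq; exists (den 5 [:: (r, [:: 4%N])]).
rewrite addrC addKr ce_diff_den; den_ring.
Qed.

Lemma ce_diff_rep_vw (r : k) : ce_diff k (rep_vw r) = 0.
Proof.
rewrite rep_vwE ce_diff_den (den_nil k 5); den_ring.
Qed.

Lemma ce_diff_rep_vx (r : k) : ce_diff k (rep_vx r) = 0.
Proof.
rewrite rep_vxE ce_diff_den (den_nil k 5); den_ring.
Qed.

Lemma ce_diff_gx : ce_diff k x = 0.
Proof.
rewrite /gx ext_gen_den ce_diff_den (den_nil k 5); den_ring.
Qed.

Lemma m3_rep_vw_0_gx (r : k) : triv_m3 (@contr k) (rep_vw r) 0 x = 0.
Proof.
(* Zero is viewed as a 2-cochain with zero coefficients, so that [m3_cochain] applies. *)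
have -> : (0 : ext k 5) = den 5 (expand (mons 2) (fun=> czero k)).
  rewrite (den_nil k 5); den_ring.
rewrite m3_cochain; den_ring.
Qed.

Lemma represents_reps (r s : k) : represents degs classes (reps r s).
Proof.
apply: forall_ord4; split; rewrite ?(tnth_nth 0) //=.
- split; [exact/(ce_homogE 2)/ext_deg_rep_vw | exact: ce_diff_rep_vw].
- exact: hclass_rep.
- split; [exact/(ce_homogE 2)/ext_deg_rep_vx | exact: ce_diff_rep_vx].
- exact: hclass_rep.
- split; [exact/(ce_homogE 1)/ext_deg_gx | exact: ce_diff_gx].
- split; [exact/(ce_homogE 1)/ext_deg_gx | exact: ce_diff_gx].
Qed.

Lemma ext_deg_gvgw : ext_deg 2 (v \w w).
Proof. by rewrite /gv /gw !ext_gen_den denM; apply: ext_deg_den. Qed.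

Lemma ext_deg_gvgx : ext_deg 2 (v \w x).
Proof. by rewrite /gv /gx !ext_gen_den denM; apply: ext_deg_den. Qed.

Lemma ext_deg_gvgz : ext_deg 2 (v \w z).
Proof. by rewrite /gv /gz !ext_gen_den denM; apply: ext_deg_den. Qed.

(** Boundaries of degree 2 are the multiples of [xy] and there are none in degree 1, so the choices
    of representatives form a two-parameter family. *)
Lemma represents_repsP y : represents degs classes y -> exists r s, y = reps r s.
Proof.
case: y => [[|y0 [|y1 [|y2 [|y3 [|//]]]]] // y4] ry.
have := (ry o0, ry o1, ry o2, ry o3).
rewrite !(tnth_nth 0) /=.
move=> [[[[[/(ce_homogE 2) d0 _] e0] [[/(ce_homogE 2) d1 _] e1]]
  [[/(ce_homogE 1) d2 _] e2]] [[/(ce_homogE 1) d3 _] e3]].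
have [r y0E] := hclass_deg2 d0 ext_deg_gvgw e0.
have [s y1E] := hclass_deg2 d1 ext_deg_gvgx e1.
exists r, s; apply: val_inj => /=; rewrite /rep_vw /rep_vx -y0E -y1E.
by rewrite (hclass_deg1 d2 ext_deg_gx e2) (hclass_deg1 d3 ext_deg_gx e3).
Qed.

(** Makes the freedom of choice explicit: [rho o1] is [vz] up to a cocycle, and [rho o2], [rho o3]
    are arbitrary cocycles of their degrees, independently of [r] and [s]. *)
Lemma massey_systemP y rho : massey_system (Gamma k) degs classes y rho <->
  exists r s, [/\ y = reps r s,
    ext_deg 3 (rho o0) /\ ce_diff k (rho o0) = rep_vw r \w rep_vx s,
    ext_deg 2 (rho o1) /\ ce_diff k (rho o1) = ce_diff k (v \w z),
    ext_deg 2 (rho o2) /\ ce_diff k (rho o2) = 0 &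
    ext_deg 1 (rho o3) /\ ce_diff k (rho o3) = 0].
Proof.
split=> [[/represents_repsP[r [s ->]] H]|[r [s [-> H0 H1 H2 H3]]]].
  exists r, s; split=> //.
  - have [] := H o0.
    by rewrite rho_deg0 inner_val0 => /(ce_homogE 3) ? ?; split.
  - have [] := H o1.
    by rewrite rho_deg1 inner_val1 m3_rep_vw_rep_vx_gx => /(ce_homogE 2) ? ?; split.
  - have [] := H o2.
    by rewrite rho_deg2 inner_val2 wedge_rep_vx_gx => /(ce_homogE 2) ? ?; split.
  - have [] := H o3.
    by rewrite rho_deg3 inner_val3 m3_rep_vx_gx_gx => /(ce_homogE 1) ? ?; split.
split; first exact: represents_reps.
apply: forall_ord4.
- by rewrite rho_deg0 inner_val0; case: H0 => ? ?; split=> //; apply/(ce_homogE 3).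
- by rewrite rho_deg1 inner_val1 m3_rep_vw_rep_vx_gx;
     case: H1 => ? ?; split=> //; apply/(ce_homogE 2).
- by rewrite rho_deg2 inner_val2 wedge_rep_vx_gx;
     case: H2 => ? ?; split=> //; apply/(ce_homogE 2).
- by rewrite rho_deg3 inner_val3 m3_rep_vx_gx_gx;
     case: H3 => ? ?; split=> //; apply/(ce_homogE 1).
Qed.

Lemma massey_defined_Gamma : massey_defined (Gamma k) degs classes.
Proof.
split=> [i|y j /represents_repsP[r [s ->]]].
  by exists (tnth (reps 0 0) i); have [] := represents_reps 0 0 i.
move: j; apply: forall_ord4.
- by rewrite inner_val0 wedge_rep_vw_rep_vx hclass_ce_diff.
- by rewrite inner_val1 m3_rep_vw_rep_vx_gx hclass_ce_diff.
- by rewrite inner_val2 wedge_rep_vx_gx hclass0.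
- by rewrite inner_val3 m3_rep_vx_gx_gx hclass0.
Qed.

Lemma massey_system_exists : exists y rho, massey_system (Gamma k) degs classes y rho.
Proof.
exists (reps 0 0),
  (* The first entry is the primitive from [wedge_rep_vw_rep_vx] at parameter 0; the default of
     [nth] supplies 0 for the last two indices. *)
  (fun j : 'I_4 => nth 0 [:: den 5 [:: (0 : k, [:: 0; 1; 4]%N)]; v \w z] j).
apply/massey_systemP; exists 0, 0; split=> //=.
- by split; [apply: ext_deg_den | rewrite wedge_rep_vw_rep_vx].
- by split; first exact: ext_deg_gvgz.
- by split=> [S|]; [rewrite ffunE eqxx | rewrite linear0].
- by split=> [S|]; [rewrite ffunE eqxx | rewrite linear0].
Qed.

(** * The indeterminacy and the coset *)

Lemma indet_outer1 a : ext_deg 2 a -> ce_diff k a = 0 -> indet_cocycle (a \w x).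
Proof.
move=> a2 /(cocycle_deg2 a2)[f [-> [f04 f14]]]; rewrite wedge_gx f04 f14 -/(czero k).
exists (f [:: 0; 1]%N), (czero k), (f [:: 3; 4]%N),
  (copp (f [:: 0; 3]%N)), (copp (f [:: 1; 3]%N)).
den_ring.
Qed.

Lemma indet_outer2 r a : ext_deg 2 a -> ce_diff k a = 0 ->
  indet_cocycle (triv_m3 (@contr k) (rep_vw r) a x).
Proof.
move=> a2 /(cocycle_deg2 a2)[f [-> [f04 f14]]]; rewrite m3_cochain f04 f14 -/(czero k).
exists (czero k), (copp (cadd (f [:: 0; 1]%N) (f [:: 0; 1]%N))), (f [:: 2; 4]%N),
  (copp (f [:: 0; 2]%N)), (copp (f [:: 1; 2]%N)).
den_ring.
Qed.

Lemma indet_outer3 r a : ext_deg 1 a -> ce_diff k a = 0 ->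
  indet_cocycle (rep_vw r \w a).
Proof.
move=> a1 /(cocycle_deg1 a1)[f0 [f1 [f2 [f3 ->]]]]; rewrite wedge_rep_vw.
by exists f2, f3, (czero k), (cmul r f0), (cmul r f1).
Qed.

Lemma indet_outer r s (u : 'I_4 -> A) :
  (forall j, cycles (rho_deg (tnth (Gamma k) j) degs) (u j)) ->
  indet_cocycle (\sum_(j < 4) outer_val (tnth (Gamma k) j) (reps r s) (u j)).
Proof.
move=> H; rewrite sum_ord4.
have := (H o0, H o1, H o2, H o3).
rewrite rho_deg0 rho_deg1 rho_deg2 rho_deg3.
move=> [[[[/(ce_homogE 3) d0 _]] [/(ce_homogE 2) d1 c1]]
  [/(ce_homogE 2) d2 c2]] [/(ce_homogE 1) d3 c3].
rewrite outer_val0 m3_gx_gx // add0r outer_val1 outer_val2 outer_val3.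
apply: indet_cocycleD; last exact: (indet_cocycleN (indet_outer3 r d3 c3)).
apply: indet_cocycleD; last exact: (indet_cocycleN (indet_outer2 r d2 c2)).
exact: indet_outer1.
Qed.

Lemma massey_cycleE r s rho : massey_system (Gamma k) degs classes (reps r s) rho ->
  exists2 b, indet_cocycle b &
    massey_cycle (Gamma k) degs (reps r s) rho = v \w (x \w z) + b.
Proof.
case/massey_systemP=> [r' [s' [_ [d0 _] [d1 c1] [d2 c2] [d3 c3]]]].
rewrite /massey_cycle sum_ord4 outer_val0 outer_val1 outer_val2 outer_val3.
rewrite massey_exp0 massey_exp1 massey_exp2 massey_exp3.
have e1 : (-1 : k) ^ (1 : int) = -1 by [].
have e2 : (-1 : k) ^ (4 : int) = 1 by rewrite -[4]/(4%:Z) -exprnP -signr_odd.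
have e3 : (-1 : k) ^ (- 2 : int) = 1.
  by rewrite -[- 2]/(- 2%:Z) -exprnN sqrrN expr1n invr1.
rewrite e1 e2 e3 !scale1r scaleN1r m3_gx_gx // scaler0 add0r.
(* Splits off [vz], which yields the leading term [vxz]; the difference is a cocycle and goes into
   the indeterminacy. *)
have -> : rho o1 = v \w z + (rho o1 - v \w z) by rewrite addrC subrK.
rewrite wedgeDl wedge_gv_gz_gx opprD opprK -!addrA.
eexists; last by reflexivity.
apply: indet_cocycleD; last apply: indet_cocycleD.
- apply/indet_cocycleN/indet_outer1; last by rewrite linearB /= c1 subrr.
  exact: ext_degB d1 ext_deg_gvgz.
- exact: (indet_cocycleN (indet_outer2 r d2 c2)).
exact: (indet_cocycleN (indet_outer3 r d3 c3)).
Qed.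

Lemma outer_surj r s b : indet_cocycle b -> exists2 u : 'I_4 -> A,
  (forall j, cycles (rho_deg (tnth (Gamma k) j) degs) (u j)) &
  hclass (A := A) b = \sum_(j < 4) hclass (outer_val (tnth (Gamma k) j) (reps r s) (u j)).
Proof.
move=> [r1 [r2 [r3 [r4 [r5 ->]]]]].
(* [(yz) x = xyz] is reached through the second summand, [vwx] and [vwy] through the fourth, whose
   coefficient -1 accounts for the signs in [u3]. *)
pose u1 : A := den 5 [:: (r3, [:: 3; 4]%N)].
pose u3 : A := den 5 [:: (czero k, [:: 0]); (czero k, [:: 1]);
  (copp r1, [:: 2]); (copp r2, [:: 3])]%N.
have deg0 m : ext_deg m (0 : A) by move=> S; rewrite ffunE eqxx.
exists (fun j : 'I_4 => nth 0 [:: 0; u1; 0; u3] j).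
  apply: forall_ord4; rewrite ?rho_deg0 ?rho_deg1 ?rho_deg2 ?rho_deg3 /=; split.
  - exact/(ce_homogE 3).
  - exact: linear0.
  - exact/(ce_homogE 2)/ext_deg_den.
  - rewrite [LHS]ce_diff_den (den_nil k 5); den_ring.
  - exact/(ce_homogE 2).
  - exact: linear0.
  - exact/(ce_homogE 1)/ext_deg_den.
  - rewrite [LHS]ce_diff_den (den_nil k 5); den_ring.
rewrite sum_ord4 outer_val0 outer_val1 outer_val2 outer_val3 /= m3_gx_gx // hclass0 add0r.
rewrite m3_rep_vw_0_gx oppr0 hclass0 addr0 wedge_rep_vw -hclassD.
rewrite /gx ext_gen_den denM denN denD.
apply/(@hclass_eq k hycom A).
(* The terms in [vxy] and [wxy] are absorbed as the boundary of [- r4 vz - r5 wz]. *)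
exists (den 5 [:: (copp r4, [:: 0; 4]); (copp r5, [:: 1; 4])]%N).
rewrite [RHS]ce_diff_den denN denD; den_ring.
Qed.

(** The right-hand side mentions neither [y] nor [rho], which gives independence of choices. One
    inclusion is [indet_outer], the other [outer_surj]. *)
Lemma massey_cosetE y rho : massey_system (Gamma k) degs classes y rho ->
  massey_coset (Gamma k) degs y rho =
  [set hclass (A := A) (v \w (x \w z) + b) | b in @indet_cocycle k]%classic.
Proof.
move=> H; have [r [s [yE _ _ _ _]]] := (massey_systemP y rho).1 H.
move: H; rewrite {}yE => /massey_cycleE[b0 Pb0 bE].
rewrite /massey_coset bE; apply/seteqP; split=> h.
  move=> [_ [u [Hu ->]] <-];
    exists (b0 + \sum_(j < 4) outer_val (tnth (Gamma k) j) (reps r s) (u j)).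
    by apply: indet_cocycleD => //; apply: indet_outer.
  by rewrite !sum_ord4 !hclassD !addrA.
move=> [b Pb <-].
(* The cycle already carries the offset [b0], so the indeterminacy has to supply [b - b0]. *)
have [u Hu uE] := outer_surj r s (indet_cocycleD Pb (indet_cocycleN Pb0)).
exists (hclass (A := A) (b - b0)); last by rewrite -hclassD -addrA (addrC b0) subrK.
by exists u.
Qed.

Lemma massey_productE : massey_product (Gamma k) degs classes =
  [set hclass (A := A) (v \w (x \w z) + b) | b in @indet_cocycle k]%classic.
Proof.
apply/seteqP; split=> h; first by move=> [y [rho [/massey_cosetE ->]]].
have [y [rho H]] := massey_system_exists.
by rewrite -(massey_cosetE H) => hH; exists y, rho.
Qed.

Lemma massey_well_defined_Gamma : massey_well_defined (Gamma k) degs classes (- 3).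
Proof.
split; first exact: massey_defined_Gamma.
- exact: massey_system_exists.
- move=> y rho H; rewrite (massey_cosetE H) massey_productE; split=> //.
  have [r [s [yE _ _ _ _]]] := (massey_systemP y rho).1 H.
  move: H; rewrite yE => /massey_cycleE[b Pb ->].
  exact: indet_coset_cycle.
rewrite massey_productE => _ [b Pb <-].
by exists (v \w (x \w z) + b) => //; apply: indet_coset_cycle.
Qed.

End Main.

Theorem proposition5p7 (k : fieldType) (chark : [pchar k] =i pred0) :
  let A := ce_hycom k in
  let v := gv k in let w := gw k in let x := gx k in let z := gz k in
  let degs : 4.-tuple int := [tuple (- 2); (- 2); (- 1); (- 1)] in
  let classes : 4.-tuple (homology A) :=
    [tuple hclass (A := A) (v \w w); hclass (A := A) (v \w x);
           hclass (A := A) x; hclass (A := A) x] in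
  [/\ massey_well_defined (Gamma k) degs classes (- 3),
      ~ massey_product (Gamma k) degs classes 0
    & (massey_product (Gamma k) degs classes `&` @kunneth_1_2 k
       = [set hclass (A := A) (v \w (x \w z))])%classic].
Proof.
move=> A v w x z degs classes; split; first exact: massey_well_defined_Gamma.
  by rewrite massey_productE => -[b /hclass_indet_neq0].
rewrite massey_productE; apply/seteqP; split=> [_ [[b Pb <-]]|_ ->].
  exact: indet_kunneth.
split; last exact: kunneth_gvxz.
by exists 0; rewrite ?addr0 //; apply: indet_cocycle0.
Qed.
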